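(* Assume that the vectors $a_0,a_1,\dots,a_n\in\mathbb R^k$ are pairwise distinct. Suppose further that for each $i\in\{1,\dots,n\}$ there is an $m\in\{0,\dots,n\}$, $m\ne i$, such that $q_{mi}>0$ and such that, for all $p,j\in\{0,\dots,n\}$, the relations $q_{pj}>0$ and $a_p-a_j=a_m-a_i$ imply $j=i$. Then Hörmander's condition holds for $(D_0^J,D_1,\dots,D_k)$ at every $\phi\in(0,\infty)^n$.
   Context: Let $1\le k<n$ be integers. Let $Q=(q_{ij})_{i,j=0}^n$ be a real matrix with $q_{ij}\ge0$ for $i\ne j$, $q_{ii}\le0$, and $\sum_{j=0}^nq_{ij}=0$ for every $i$. Let $\lambda_0,\dots,\lambda_n\in\mathbb R^k$ be pairwise distinct, with $\lambda_0$ a vertex of their convex hull. Put $a_i:=\lambda_i-\lambda_0$ for $0\le i\le n$ (so $a_0=0$), with components $a_{ir}$ ($1\le r\le k$), and $\Sigma_{ij}:=a_i\cdot a_j$. For $\phi\in(0,\infty)^n$ let $\phi_0:=1$ and $y(\phi):=1+\sum_{i=1}^n\phi_i$. Define vector fields on $(0,\infty)^n$: $$D_r=\sum_{j=1}^na_{jr}\phi_j\,\partial_{\phi_j}\ (1\le r\le k),\qquad D_0=\sum_{j=1}^n\Big(\frac1{y(\phi)}\sum_{i=1}^n\Sigma_{ij}\phi_i\phi_j-\frac12\|a_j\|^2\phi_j\Big)\partial_{\phi_j},$$ $$J=\sum_{j=1}^n\sum_{i=0}^n(q_{ij}-q_{i0}\phi_j)\phi_i\,\partial_{\phi_j},\qquad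 D_0^J=D_0+J.$$ Lie bracket: $[F,G]=FG-GF$. Hörmander's condition holds at $\phi$ if the values at $\phi$ of the fields $D_0^J,D_1,\dots,D_k$ and of all their iterated Lie brackets span $\mathbb R^n$. *)

(* Defs.v *)
From mathcomp Require Import all_boot all_order all_algebra.
From mathcomp Require Import all_classical all_reals all_analysis.

Set Implicit Arguments.
Unset Strict Implicit.
Unset Printing Implicit Defensive.

Import Order.TTheory GRing.Theory Num.Theory.
Import numFieldNormedType.Exports.

Local Open Scope classical_set_scope.
Local Open Scope ring_scope.

Definition convex_hull (R : realType) (k : nat) (A : set 'rV[R]_k) :
    set 'rV[R]_k :=
  smallest [set B | convex_set (B : set (convex_lmodType 'rV[R]_k))] A.

(* Vertices of a polytope are its extreme points. *)
Definition is_vertex (R : realType) (k : nat) (C : set 'rV[R]_k)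
    (x : 'rV[R]_k) : Prop :=
  C x /\ forall (u v : 'rV[R]_k) (t : R), C u -> C v -> 0 < t < 1 ->
    x = t *: u + (1 - t) *: v -> u = x /\ v = x.

(* The Euclidean inner product; the library norm on row vectors is the
   sup norm. *)
Definition dotp (R : realType) (k : nat) (u v : 'rV[R]_k) : R :=
  \sum_(r < k) u 0 r * v 0 r.

Definition orthant (R : realType) (n : nat) : set 'rV[R]_n :=
  [set phi | forall j, 0 < phi 0 j].

(* The vector field \sum_j F_j \partial_j, given by its components.  The
   fields are total functions on R^n, but the orthant is open, so values and
   iterated derivatives at its points depend only on the restriction of the
   fields to the orthant. *)
Definition vfield (R : realType) (n : nat) : Type := 'rV[R]_n -> 'rV[R]_n.

Definition vf_apply (R : realType) (n : nat) (F : vfield R n)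
    (f : 'rV[R]_n -> R) (phi : 'rV[R]_n) : R :=
  \sum_(j < n) F phi 0 j * 'D_(delta_mx 0 j) f phi.

(* [F, G] = FG - GF is again a first order operator; its j-th component is
   its value on the j-th coordinate function. *)
Definition lie_bracket (R : realType) (n : nat) (F G : vfield R n) :
    vfield R n :=
  fun phi => \row_(j < n)
    let x_j := fun psi : 'rV[R]_n => psi 0 j in
    (vf_apply F (vf_apply G x_j) phi - vf_apply G (vf_apply F x_j) phi).

Inductive iterated_bracket (R : realType) (n : nat) (gen : set (vfield R n)) :
    vfield R n -> Prop :=
  | ib_gen F : gen F -> iterated_bracket gen F
  | ib_bracket F G : iterated_bracket gen F -> iterated_bracket gen G ->
      iterated_bracket gen (lie_bracket F G).

Definition hormander_at (R : realType) (n : nat) (gen : set (vfield R n))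
    (phi : 'rV[R]_n) : Prop :=
  forall v : 'rV[R]_n, exists (m : nat) (F : 'I_m -> vfield R n) (c : 'I_m -> R),
    (forall i, iterated_bracket gen (F i)) /\ v = \sum_(i < m) c i *: F i phi.

Section Fields.
Variables (R : realType) (k n : nat).
Variables (q : 'M[R]_n.+1) (a : 'I_n.+1 -> 'rV[R]_k).

(* Coordinates of R^n are indexed by 'I_n; the index j : 'I_n corresponds to
   the index lift ord0 j of {0, ..., n}. *)
Definition phi_ext (phi : 'rV[R]_n) (i : 'I_n.+1) : R :=
  if unlift ord0 i is Some j then phi 0 j else 1.

Definition ysum (phi : 'rV[R]_n) : R := 1 + \sum_(i < n) phi 0 i.

Definition Sigma (i j : 'I_n.+1) : R := dotp (a i) (a j).

Definition Dr (r : 'I_k) : vfield R n :=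
  fun phi => \row_(j < n) (a (lift ord0 j) 0 r * phi 0 j).

Definition D0 : vfield R n := fun phi => \row_(j < n)
  ((ysum phi)^-1 * (\sum_(i < n)
      Sigma (lift ord0 i) (lift ord0 j) * phi 0 i * phi 0 j)
   - 2^-1 * dotp (a (lift ord0 j)) (a (lift ord0 j)) * phi 0 j).

Definition Jfield : vfield R n := fun phi => \row_(j < n)
  \sum_(i < n.+1)
    (q i (lift ord0 j) - q i ord0 * phi 0 j) * phi_ext phi i.

Definition D0J : vfield R n := fun phi => D0 phi + Jfield phi.

Definition generators : set (vfield R n) := [set D0J] `|` range Dr.

End Fields.

(* Main.v *)
(* Call a_p - a_l the weight of the field phi_p \partial_l, where phi_0 = 1 and
   \partial_0 = - \sum_j phi_j \partial_j.  This field is an eigenvector of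
   ad D_r for the r-th coordinate of its weight, and J is a combination of such
   fields with coefficients q_pl.  In logarithmic coordinates D_0 is a
   combination of the D_r with function coefficients plus a constant field that
   commutes with the D_r, so modulo the values of the D_r a nontrivial word in
   the ad D_r acts on D_0^J as it does on J.  Polynomials without constant term
   in the ad D_r separate the finitely many nonzero weights; by hypothesis the
   part of J of weight a_m - a_i is the single term q_mi phi_m \partial_i, hence
   \partial_i lies in the span. *)
Require Import Defs.
From HB Require Import structures.
From mathcomp Require Import all_boot all_order all_algebra.
From mathcomp Require Import all_classical all_reals all_analysis.
From mathcomp Require Import ring.
Set Implicit Arguments.
Unset Strict Implicit.
Unset Printing Implicit Defensive.
Import Order.TTheory GRing.Theory Num.Theory.
Import numFieldNormedType.Exports.
Local Open Scope classical_set_scope.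
Local Open Scope ring_scope.

(** * Derivatives along the fields \sum_i b_i phi_i \partial_i *)

Section EulerDerivative.
Variables (R : realType) (n : nat).
Implicit Types (b : 'I_n -> R) (f g : 'rV[R]_n -> R) (phi : 'rV[R]_n).

(** The witness [df] records that the partial derivatives exist, together with the value; only
    points of the orthant count, where [ysum] is positive. *)
Definition euler_derives b f g : Prop := forall phi, orthant phi ->
  exists2 df : 'I_n -> R, forall i, is_derive phi (delta_mx 0 i) f (df i) &
    \sum_(i < n) b i * phi 0 i * df i = g phi.

Lemma near_orthant phi : orthant phi -> \forall psi \near phi, orthant psi.
Proof.
move=> phi0; near=> psi => j; move: j; near: psi; apply: filter_forall => j.
apply: cvgr_gt (phi0 j); exact: coord_continuous.
Unshelve. all: by end_near. Qed.

(** The orthant is open, so derivatives at its points see only values on it. *)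
Lemma euler_derives_local b f g f' g' :
  (forall phi, orthant phi -> f phi = f' phi) ->
  (forall phi, orthant phi -> g phi = g' phi) ->
  euler_derives b f g -> euler_derives b f' g'.
Proof.
move=> ff' gg' fg phi phi0; have [df hdf hs] := fg _ phi0.
exists df => [i|]; last by rewrite hs gg'.
apply: near_eq_is_derive (hdf i).
near=> psi; apply: ff'; near: psi; exact: near_orthant.
Unshelve. all: by end_near. Qed.

Lemma is_derive_coord phi (i j : 'I_n) :
  is_derive phi (delta_mx 0 i) (fun psi : 'rV[R]_n => psi 0 j) (i == j)%:R.
Proof.
pose f := fun psi : 'rV[R]_n => psi 0 j.
have flin : linear f by move=> c u v; rewrite /f !mxE.
pose fL : {linear 'rV[R]_n -> R} := HB.pack f (GRing.isLinear.Build _ _ _ _ f flin).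
have fcont : continuous fL by exact: coord_continuous.
have fdiff : differentiable fL phi by exact: linear_differentiable.
apply: DeriveDef; first exact: diff_derivable.
rewrite (deriveE _ fdiff) (diff_lin _ fcont) /= /f.
by rewrite mxE eqxx eq_sym.
Qed.

Lemma euler_derives_cst b (c : R) : euler_derives b (fun=> c) (fun=> 0).
Proof.
move=> phi _; exists (fun=> 0) => [i|]; first exact: is_derive_cst.
by rewrite big1 // => i _; rewrite mulr0.
Qed.

Lemma euler_derives_coord b j :
  euler_derives b (fun phi => phi 0 j) (fun phi => b j * phi 0 j).
Proof.
move=> phi _; exists (fun i => (i == j)%:R) => [i|]; first exact: is_derive_coord.
rewrite (bigD1 j) //= eqxx mulr1 big1 ?addr0 // => i /negPf ->.
by rewrite mulr0.
Qed.

Lemma euler_derivesD b f g f' g' : euler_derives b f f' ->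
  euler_derives b g g' ->
  euler_derives b (fun phi => f phi + g phi) (fun phi => f' phi + g' phi).
Proof.
move=> hf hg phi phi0.
have [df hdf <-] := hf _ phi0; have [dg hdg <-] := hg _ phi0.
exists (fun i => df i + dg i) => [i|]; first exact: is_deriveD.
by rewrite -big_split; apply: eq_bigr => i _; rewrite mulrDr.
Qed.

Lemma euler_derivesM b f g f' g' : euler_derives b f f' ->
  euler_derives b g g' ->
  euler_derives b (fun phi => f phi * g phi)
    (fun phi => f' phi * g phi + f phi * g' phi).
Proof.
move=> hf hg phi phi0.
have [df hdf <-] := hf _ phi0; have [dg hdg <-] := hg _ phi0.
exists (fun i => f phi *: dg i + g phi *: df i) => [i|]; first exact: is_deriveM.
rewrite mulr_suml mulr_sumr -big_split; apply: eq_bigr => i _ /=.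
by rewrite /GRing.scale /=; ring.
Qed.

Lemma euler_derivesV b f f' : (forall phi, orthant phi -> f phi != 0) ->
  euler_derives b f f' ->
  euler_derives b (fun phi => (f phi)^-1)
    (fun phi => - ((f phi)^-1 * (f phi)^-1 * f' phi)).
Proof.
move=> f0 hf phi phi0.
have [df hdf <-] := hf _ phi0.
exists (fun i => - (f phi) ^- 2 *: df i) => [i|].
  have df' : derivable f phi (delta_mx 0 i) by case: (hdf i).
  apply: DeriveDef; first by apply: derivableV => //; exact: f0.
  rewrite deriveV ?f0 //; case: (hdf i) => _ -> //.
rewrite mulr_sumr -sumrN; apply: eq_bigr => i _.
by rewrite /GRing.scale /= expr2 invfM; ring.
Qed.

Lemma euler_derives_sum b (I : Type) (s : seq I) (f f' : I -> 'rV[R]_n -> R) :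
  (forall i, euler_derives b (f i) (f' i)) ->
  euler_derives b (fun phi => \sum_(i <- s) f i phi)
    (fun phi => \sum_(i <- s) f' i phi).
Proof.
move=> hf; elim: s => [|i s IHs].
  by apply: euler_derives_local (euler_derives_cst b 0) => phi _;
    rewrite big_nil.
by apply: euler_derives_local (euler_derivesD (hf i) IHs) => phi _;
  rewrite big_cons.
Qed.

Lemma euler_derives_ysum b :
  euler_derives b (@ysum R n) (fun phi => \sum_(i < n) b i * phi 0 i).
Proof.
apply: (@euler_derives_local _ (fun phi => 1 + \sum_(i < n) phi 0 i)
  (fun phi => 0 + \sum_(i < n) b i * phi 0 i)) => // [phi _|].
  by rewrite add0r.
apply: euler_derivesD; first exact: euler_derives_cst.
apply: euler_derives_sum => i; exact: euler_derives_coord.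
Qed.

Lemma ysum_gt0 phi : orthant phi -> 0 < ysum phi.
Proof.
move=> phi0; rewrite /ysum ltr_wpDr // sumr_ge0 // => i _; exact/ltW/phi0.
Qed.

(* A class of functions that contains the coefficients of [D0] in terms of the
   [Dr] and is stable under every Euler derivative. *)
Inductive yrational : ('rV[R]_n -> R) -> Prop :=
  | yrational_cst c : yrational (fun=> c)
  | yrational_coord j : yrational (fun phi => phi 0 j)
  | yrational_ysumV : yrational (fun phi => (ysum phi)^-1)
  | yrationalD f g : yrational f -> yrational g ->
      yrational (fun phi => f phi + g phi)
  | yrationalM f g : yrational f -> yrational g ->
      yrational (fun phi => f phi * g phi).

Lemma yrational_sum (I : Type) (s : seq I) (f : I -> 'rV[R]_n -> R) :
  (forall i, yrational (f i)) -> yrational (fun phi => \sum_(i <- s) f i phi).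
Proof.
move=> hf; elim: s => [|i s IHs].
  by under eq_fun do rewrite big_nil; exact: yrational_cst.
by under eq_fun do rewrite big_cons; exact: yrationalD.
Qed.

Lemma yrational_euler b f :
  yrational f -> exists2 f', yrational f' & euler_derives b f f'.
Proof.
elim=> [c|j||{}f g hf [f' hf' ff'] hg [g' hg' gg']
  |{}f g hf [f' hf' ff'] hg [g' hg' gg']].
- by exists (fun=> 0); [exact: yrational_cst|exact: euler_derives_cst].
- exists (fun phi => b j * phi 0 j); last exact: euler_derives_coord.
  by apply: yrationalM; [exact: yrational_cst|exact: yrational_coord].
(* The sign is a constant factor, as the constructors of [yrational] produce it. *)
- exists (fun phi => -1 * ((ysum phi)^-1 * (ysum phi)^-1 *
      \sum_(i < n) b i * phi 0 i)).
    apply: yrationalM; first exact: yrational_cst.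
    apply: yrationalM; first by apply: yrationalM; exact: yrational_ysumV.
    apply: yrational_sum => i.
    by apply: yrationalM; [exact: yrational_cst|exact: yrational_coord].
  have y0 phi : orthant phi -> ysum phi != 0.
    by move=> phi0; rewrite gt_eqF ?ysum_gt0.
  apply: euler_derives_local (euler_derivesV y0 (euler_derives_ysum b)) => //.
  by move=> phi _; rewrite mulN1r.
- by exists (fun phi => f' phi + g' phi);
    [exact: yrationalD|exact: euler_derivesD].
- exists (fun phi => f' phi * g phi + f phi * g' phi);
    last exact: euler_derivesM.
  by apply: yrationalD; exact: yrationalM.
Qed.

End EulerDerivative.

(** * Brackets with the D_r in normal form *)

Section Brackets.
Variables (R : realType) (k n : nat).
Variables (q : 'M[R]_n.+1) (a : 'I_n.+1 -> 'rV[R]_k).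
Hypothesis a0 : a ord0 = 0.
Implicit Types (r s : 'I_k) (p l : 'I_n.+1) (phi : 'rV[R]_n).

Let b r (j : 'I_n) : R := a (lift ord0 j) 0 r.

Lemma vf_apply_coord (G : vfield R n) (j : 'I_n) phi :
  vf_apply G (fun psi : 'rV[R]_n => psi 0 j) phi = G phi 0 j.
Proof.
rewrite /vf_apply (bigD1 j) //= big1 => [|i /negPf ij].
  by have [_ ->] := is_derive_coord phi j j; rewrite eqxx mulr1 addr0.
by have [_ ->] := is_derive_coord phi i j; rewrite ij mulr0.
Qed.

(** The j-th component of [D_r, G] is D_r G_j minus G(b_rj phi_j) = b_rj G_j; the hypothesis has the
    latter term on the other side. *)
Lemma lie_bracket_Dr r (G H : vfield R n) :
  (forall j, euler_derives (b r) (fun psi => G psi 0 j)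
                           (fun psi => H psi 0 j + b r j * G psi 0 j)) ->
  forall phi, orthant phi -> lie_bracket (Dr a r) G phi = H phi.
Proof.
move=> GH phi phi0; apply/rowP => j; rewrite mxE /=.
have coordE (F : vfield R n) :
    vf_apply F (fun psi : 'rV[R]_n => psi 0 j) = fun psi => F psi 0 j.
  by apply/funext => psi; rewrite vf_apply_coord.
rewrite !coordE; apply/eqP; rewrite subr_eq; apply/eqP.
have [df hdf GHphi] := GH j _ phi0.
transitivity (\sum_(i < n) b r i * phi 0 i * df i).
  by apply: eq_bigr => i _; rewrite mxE; case: (hdf i) => _ ->.
rewrite GHphi; congr (_ + _).
rewrite -vf_apply_coord /vf_apply mulr_sumr; apply: eq_bigr => i _.
have [dj _] := is_derive_coord phi i j.
have -> : (fun psi => Dr a r psi 0 j) =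
    b r j \*: (fun psi : 'rV[R]_n => psi 0 j).
  by apply/funext => psi; rewrite /Dr mxE.
by rewrite deriveZ // /GRing.scale /= mulrCA.
Qed.

(* With the convention that \partial_0 stands for - \sum_j phi_j \partial_j,
   this is the field phi_p \partial_l, so that J = \sum_(p, l) q_pl jump p l;
   it is an eigenvector of ad D_r for the eigenvalue (a_p - a_l)_r. *)
Definition jump p l : vfield R n := fun phi => \row_(j < n)
  (((l == lift ord0 j)%:R - (l == ord0)%:R * phi 0 j) * phi_ext phi p).

Definition weight p l : 'rV[R]_k := a p - a l.

Definition normal_form (f : 'I_n.+1 -> 'I_n.+1 -> R)
    (h : 'I_k -> 'rV[R]_n -> R) (c : 'I_n -> R) : vfield R n :=
  fun phi => \row_(j < n) (\sum_p \sum_l f p l * jump p l phi 0 j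
    + \sum_s h s phi * (b s j * phi 0 j) + c j * phi 0 j).

Lemma normal_formE f h c phi j : normal_form f h c phi 0 j =
  \sum_p \sum_l f p l * jump p l phi 0 j
  + \sum_s h s phi * (b s j * phi 0 j) + c j * phi 0 j.
Proof. by rewrite mxE. Qed.

Lemma Jfield_jump phi :
  Jfield q phi = \row_(j < n) \sum_p \sum_l q p l * jump p l phi 0 j.
Proof.
apply/rowP => j; rewrite !mxE; apply: eq_bigr => p _.
under eq_bigr do rewrite mxE mulrA mulrBr mulrBl.
rewrite sumrB mulrBl; congr (_ - _).
  rewrite (bigD1 (lift ord0 j)) //= eqxx mulr1 big1 ?addr0 // => l /negPf ->.
  by rewrite mulr0 mul0r.
rewrite (bigD1 ord0) //= mul1r big1 ?addr0 // => l /negPf ->.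
by rewrite mul0r mulr0 mul0r.
Qed.

(** Expanding Sigma_ij = \sum_s a_is a_js and exchanging the sums turns the quadratic part of D_0
    into a combination of the D_s. *)
Lemma D0J_normal_form phi :
  D0J q a phi = normal_form q
    (fun s phi => (ysum phi)^-1 * \sum_(i < n) b s i * phi 0 i)
    (fun j => - (2^-1 * dotp (a (lift ord0 j)) (a (lift ord0 j)))) phi.
Proof.
rewrite /D0J Jfield_jump; apply/rowP => j; rewrite !mxE addrC -addrA.
congr (_ + _); rewrite mulNr; congr (_ - _).
under [RHS]eq_bigr do rewrite -mulrA.
rewrite -mulr_sumr; congr (_ * _).
under [RHS]eq_bigr do rewrite mulr_suml.
rewrite exchange_big; apply: eq_bigr => i _ /=.
rewrite /Sigma /dotp !mulr_suml; apply: eq_bigr => s _; rewrite /b; ring.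
Qed.

(** The constant phi_0 = 1 has derivative 0, which fits a_0 = 0. *)
Lemma euler_derives_phi_ext r p :
  euler_derives (b r) (fun phi => phi_ext phi p)
    (fun phi => a p 0 r * phi_ext phi p).
Proof.
rewrite /phi_ext; case: unliftP => [j ->|->]; first exact: euler_derives_coord.
apply: euler_derives_local (euler_derives_cst _ 1) => // phi _.
by rewrite a0 mxE mul0r.
Qed.

(** The bracket subtracts the summand [b r j] again and leaves the weight as eigenvalue. *)
Lemma euler_derives_jump r p l j :
  euler_derives (b r) (fun phi => jump p l phi 0 j)
    (fun phi => (weight p l 0 r + b r j) * jump p l phi 0 j).
Proof.
have cst c := euler_derives_cst (b r) c.
have h := euler_derivesM
  (euler_derivesD (cst (l == lift ord0 j)%:R)
    (euler_derivesM (cst (- (l == ord0)%:R)) (euler_derives_coord (b r) j)))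
  (euler_derives_phi_ext r p).
apply: euler_derives_local h => phi _; rewrite !mxE ?mulNr //.
(* Component j is - phi_p phi_j for l = 0, phi_p for l = j, and 0 otherwise. *)
have [->|l0] := eqVneq l ord0.
  by rewrite a0 mxE (negPf (neq_lift _ _)) /=; ring.
have [->|lj] := eqVneq l (lift ord0 j); rewrite /b /=; ring.
Qed.

(** D_r commutes with every D_s and with the field given by [c], so only the weights of the jumps
    and the derivatives of the [h s] enter. *)
Lemma euler_derives_normal_form r f (h h' : 'I_k -> 'rV[R]_n -> R) c j :
  (forall s, euler_derives (b r) (h s) (h' s)) ->
  euler_derives (b r) (fun phi => normal_form f h c phi 0 j)
    (fun phi => normal_form (fun p l => f p l * weight p l 0 r) h' (fun=> 0)
                  phi 0 j + b r j * normal_form f h c phi 0 j).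
Proof.
move=> hh'.
have cst c' := euler_derives_cst (b r) c'.
have coord := euler_derives_coord (b r) j.
have d := euler_derivesD (euler_derivesD
  (euler_derives_sum (index_enum _) (fun p =>
     euler_derives_sum (index_enum _) (fun l =>
       euler_derivesM (cst (f p l)) (euler_derives_jump r p l j))))
  (euler_derives_sum (index_enum _) (fun s =>
     euler_derivesM (hh' s) (euler_derivesM (cst (b s j)) coord))))
  (euler_derivesM (cst (c j)) coord).
apply: euler_derives_local d => phi _; rewrite !normal_formE // !mulrDr.
rewrite [RHS]addrACA [X in _ = X + _]addrACA; congr (_ + _ + _); last by ring.
- rewrite mulr_sumr -big_split; apply: eq_bigr => p _ /=.
  rewrite mulr_sumr -big_split; apply: eq_bigr => l _ /=; ring.
- rewrite mulr_sumr -big_split; apply: eq_bigr => s _ /=; ring.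
Qed.

(** Induction on the word, one bracket per letter. Rationality of [h] is carried along so that it
    can be differentiated again; [c] disappears with the first bracket. *)
Lemma bracket_normal_form (w : seq 'I_k) :
  exists (F : vfield R n) (h : 'I_k -> 'rV[R]_n -> R) (c : 'I_n -> R),
    [/\ iterated_bracket (generators q a) F,
        forall s, yrational (h s),
        w != [::] -> forall j, c j = 0 &
        forall phi, orthant phi -> F phi =
          normal_form (fun p l => q p l * \prod_(r <- w) weight p l 0 r) h c
            phi].
Proof.
elim: w => [|r w [F [h [c [bF hh _ FE]]]]].
  exists (D0J q a), (fun s phi => (ysum phi)^-1 * \sum_(i < n) b s i * phi 0 i),
    (fun j => - (2^-1 * dotp (a (lift ord0 j)) (a (lift ord0 j)))).
  split=> // [|s|phi _].
  - by apply: ib_gen; left.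
  - apply: yrationalM; first exact: yrational_ysumV.
    apply: yrational_sum => i.
    by apply: yrationalM; [exact: yrational_cst|exact: yrational_coord].
  - rewrite D0J_normal_form; apply/rowP => j; rewrite !mxE.
    by do 2!congr (_ + _); apply: eq_bigr => p _; apply: eq_bigr => l _;
      rewrite big_nil mulr1.
have [h' hh' dh] : exists2 h' : 'I_k -> 'rV[R]_n -> R,
    forall s, yrational (h' s) & forall s, euler_derives (b r) (h s) (h' s).
  have H s : exists g, yrational g /\ euler_derives (b r) (h s) g.
    by have [g] := yrational_euler (b r) (hh s); exists g.
  have [h' hh'] := choice H.
  by exists h' => s; have [] := hh' s.
exists (lie_bracket (Dr a r) F), h', (fun=> 0); split=> // [|phi phi0].
  by apply: ib_bracket => //; apply: ib_gen; right; exists r.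
rewrite (@lie_bracket_Dr _ _ (normal_form
  (fun p l => q p l * (\prod_(r <- w) weight p l 0 r) * weight p l 0 r) h'
  (fun=> 0))) // => [|j].
  apply/rowP => j; rewrite !mxE; do 2!congr (_ + _).
  apply: eq_bigr => p _; apply: eq_bigr => l _.
  by rewrite big_cons; ring.
apply: euler_derives_local (euler_derives_normal_form _ c j dh) => psi psi0;
  by rewrite FE.
Qed.

Lemma phi_ext_gt0 phi p : orthant phi -> 0 < phi_ext phi p.
Proof. by move=> phi0; rewrite /phi_ext; case: unlift => [j|]. Qed.

Lemma jump_lift p (i : 'I_n) phi :
  jump p (lift ord0 i) phi = phi_ext phi p *: delta_mx 0 i.
Proof.
apply/rowP => j; rewrite !mxE eqxx (inj_eq lift_inj) [j == i]eq_sym /=.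
by rewrite mul0r subr0 mulrC.
Qed.

(** For a polynomial [f] this is the value of f(ad D_1, ..., ad D_k) applied to J. *)
Definition weighted_J (f : 'rV[R]_k -> R) phi : 'rV[R]_n :=
  \sum_p \sum_l (q p l * f (weight p l)) *: jump p l phi.

(** * Separation of the weights within the span of the brackets *)

Section Span.
Variable phi : 'rV[R]_n.
Hypothesis phi0 : orthant phi.

(** By conversion, the condition that [hormander_at] imposes on each vector. *)
Definition bracket_span (v : 'rV[R]_n) : Prop :=
  exists (m : nat) (F : 'I_m -> vfield R n) (c : 'I_m -> R),
    (forall i, iterated_bracket (generators q a) (F i)) /\
    v = \sum_(i < m) c i *: F i phi.

Lemma bracket_span_gen F :
  iterated_bracket (generators q a) F -> bracket_span (F phi).
Proof.
move=> bF; exists 1%N, (fun=> F), (fun=> 1); split => //.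
by rewrite big_ord1 scale1r.
Qed.

Lemma bracket_spanD u v :
  bracket_span u -> bracket_span v -> bracket_span (u + v).
Proof.
move=> [m1 [F1 [c1 [b1 ->]]]] [m2 [F2 [c2 [b2 ->]]]].
exists (m1 + m2)%N,
  (fun i => match fintype.split i with inl i1 => F1 i1 | inr i2 => F2 i2 end),
  (fun i => match fintype.split i with inl i1 => c1 i1 | inr i2 => c2 i2 end).
split=> [i|]; first by case: fintype.split.
rewrite big_split_ord; congr (_ + _); apply: eq_bigr => i _.
  by rewrite (unsplitK (inl i)).
by rewrite (unsplitK (inr i)).
Qed.

Lemma bracket_spanZ (x : R) v : bracket_span v -> bracket_span (x *: v).
Proof.
move=> [m [F [c [bF ->]]]]; exists m, F, (fun i => x * c i); split => //.
by rewrite scaler_sumr; apply: eq_bigr => i _; rewrite scalerA.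
Qed.

Lemma bracket_span_sum (I : Type) (s : seq I) (v : I -> 'rV[R]_n) :
  (forall i, bracket_span (v i)) -> bracket_span (\sum_(i <- s) v i).
Proof.
move=> hv; elim/big_ind: _ => //; last exact: bracket_spanD.
exists 0%N, (fun=> fun=> 0), (fun=> 0).
by split=> [[]//|]; rewrite big_ord0.
Qed.

Lemma weighted_J_monomial (w : seq 'I_k) : w != [::] ->
  bracket_span (weighted_J (fun nu => \prod_(r <- w) nu 0 r) phi).
Proof.
move=> w0; have [F [h [c [bF _ c0 FE]]]] := bracket_normal_form w.
(* For a nonempty word [c] vanishes, and subtracting values of the generators D_s removes the [h]
   part. *)
have -> : weighted_J (fun nu => \prod_(r <- w) nu 0 r) phi =
    F phi + \sum_s - h s phi *: Dr a s phi.
  apply/rowP => j; rewrite FE // [RHS]mxE normal_formE !summxE c0 // mul0r addr0.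
  under [X in _ + X]eq_bigr do rewrite !mxE mulNr.
  rewrite sumrN addrK; apply: eq_bigr => p _; rewrite summxE.
  by apply: eq_bigr => l _; rewrite mxE.
apply: bracket_spanD; first exact: bracket_span_gen.
apply: bracket_span_sum => s; apply: bracket_spanZ.
by apply: bracket_span_gen; apply: ib_gen; right; exists s.
Qed.

(* The functions f for which this holds are closed under multiplication by
   affine functions of the coordinates; they contain the coordinates, but not
   1, since only nontrivial brackets get rid of the constant part of [D0]. *)
Definition admissible (f : 'rV[R]_k -> R) : Prop := forall w : seq 'I_k,
  bracket_span (weighted_J (fun nu => f nu * \prod_(r <- w) nu 0 r) phi).

Lemma admissible_coord r : admissible (fun nu => nu 0 r).
Proof.
move=> w; have := @weighted_J_monomial (r :: w) isT.
by under eq_fun do rewrite big_cons.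
Qed.

(** A factor nu_r becomes one more letter of the word, which is why admissibility quantifies over
    words. *)
Lemma admissible_mul f r (x : R) :
  admissible f -> admissible (fun nu => f nu * (nu 0 r - x)).
Proof.
move=> hf w.
rewrite (_ : weighted_J _ phi =
  weighted_J (fun nu => f nu * \prod_(r <- (r :: w)) nu 0 r) phi +
  (- x) *: weighted_J (fun nu => f nu * \prod_(r <- w) nu 0 r) phi).
  by apply: bracket_spanD; [exact: hf|apply: bracket_spanZ; exact: hf].
rewrite scaler_sumr -big_split; apply: eq_bigr => p _ /=.
rewrite scaler_sumr -big_split; apply: eq_bigr => l _ /=.
by rewrite scalerA -scalerDl big_cons; congr (_ *: _); ring.
Qed.

(** Interpolation: start from a coordinate that is nonzero at [mu], then multiply, for each other
    weight, by an affine factor in a coordinate where it differs from [mu]. *)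
Lemma admissible_separate (mu : 'rV[R]_k) (s : seq 'rV[R]_k) : mu != 0 ->
  exists f, [/\ admissible f, f mu != 0 &
    forall nu, nu \in s -> nu != mu -> f nu = 0].
Proof.
move=> /rV0Pn [r0 mu0]; elim: s => [|nu s [f [hf fmu fs]]].
  by exists (fun nu => nu 0 r0); split => //; exact: admissible_coord.
have [->|numu] := eqVneq nu mu.
  by exists f; split => // xi; rewrite in_cons => /orP[/eqP ->|/fs//]; rewrite eqxx.
have [r hr] : exists r, (mu - nu) 0 r != 0.
  by apply/rV0Pn; rewrite subr_eq0 eq_sym.
exists (fun xi => f xi * (xi 0 r - nu 0 r)); split.
- exact: admissible_mul.
- by rewrite mulf_neq0 //; move: hr; rewrite !mxE.
- move=> xi; rewrite in_cons => /orP[/eqP -> _|/fs fxi /fxi ->].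
    by rewrite subrr mulr0.
  by rewrite mul0r.
Qed.

Lemma bracket_span_delta p (i : 'I_n) :
  weight p (lift ord0 i) != 0 -> q p (lift ord0 i) != 0 ->
  (forall p' l, weight p' l = weight p (lift ord0 i) ->
    q p' l != 0 -> (p', l) = (p, lift ord0 i)) ->
  bracket_span (delta_mx 0 i).
Proof.
set l := lift ord0 i => mu0 qpl uniq_pl.
have [f [hf fmu fs]] := admissible_separate
  [seq weight pl.1 pl.2 | pl : 'I_n.+1 * 'I_n.+1] mu0.
(* [f] kills all other weights, and at the remaining one only (p, l) has a nonzero entry of [q]. *)
have E : weighted_J f phi = (q p l * f (weight p l)) *: jump p l phi.
  rewrite /weighted_J pair_bigA (bigD1 (p, l)) //= big1 ?addr0 // => -[p' l'].
  move=> /= neq; have [->|qpl'] := eqVneq (q p' l') 0.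
    by rewrite mul0r scale0r.
  rewrite fs ?mulr0 ?scale0r //.
    exact: (fintype.image_f (fun pl => weight pl.1 pl.2) (x := (p', l'))).
  by apply: contra neq => /eqP /uniq_pl ->.
have := hf [::]; under eq_fun do rewrite big_nil mulr1.
(* The surviving term is a nonzero multiple of \partial_i because phi_p > 0. *)
rewrite E jump_lift scalerA => /(bracket_spanZ (q p l * f (weight p l) * phi_ext phi p)^-1).
by rewrite scalerA mulVf ?scale1r // !mulf_neq0 // gt_eqF // phi_ext_gt0.
Qed.

End Span.
End Brackets.

Theorem theorem4p8 (R : realType) (k n : nat) (q : 'M[R]_n.+1)
    (lam : 'I_n.+1 -> 'rV[R]_k) (a : 'I_n.+1 -> 'rV[R]_k)
    (hk : (1 <= k)%N) (hkn : (k < n)%N)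
    (q_offdiag : forall i j, i != j -> 0 <= q i j)
    (q_diag : forall i, q i i <= 0)
    (q_sum : forall i, \sum_(j < n.+1) q i j = 0)
    (lam_inj : injective lam)
    (lam0_vertex : is_vertex (convex_hull (range lam)) (lam ord0))
    (a_def : forall i, a i = lam i - lam ord0)
    (a_inj : injective a)
    (hyp : forall i : 'I_n.+1, i != ord0 ->
       exists m : 'I_n.+1,
         [/\ m != i, 0 < q m i &
             forall p j : 'I_n.+1,
               0 < q p j -> a p - a j = a m - a i -> j = i]) :
  forall phi : 'rV[R]_n, orthant phi -> hormander_at (generators q a) phi.
Proof.
move=> phi phi0 v.
have a0 : a ord0 = 0 by rewrite a_def subrr.
rewrite (row_sum_delta v); apply: bracket_span_sum => i; apply: bracket_spanZ.
have [m [mi qmi uniq_mi]] := hyp (lift ord0 i) isT.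
have mu0 : weight a m (lift ord0 i) != 0.
  by rewrite subr_eq0 (inj_eq a_inj).
apply: (bracket_span_delta a0 phi0 mu0); first by rewrite gt_eqF.
move=> p l wpl qpl0.
(* Diagonal pairs have weight 0, unlike (m, i); off the diagonal a nonzero entry of [q] is positive,
   as [hyp] demands. *)
have pl : p != l.
  by apply: contra_eq_neq wpl => ->; rewrite /weight subrr eq_sym.
have qpl : 0 < q p l by rewrite lt0r qpl0 q_offdiag.
(* [hyp] gives only l = i; then a_p = a_m, and injectivity of [a] gives p = m. *)
have li := uniq_mi _ _ qpl wpl; rewrite li in wpl *.
by rewrite (a_inj _ _ (addIr _ wpl)).
Qed.
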